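(* Let $k\ge a\ge 1$ be integers. For $n\ge 0$ let $\overline{P}_{k,a}(n)$ denote the number of lattice paths $L$ that satisfy the special $(k,a)$-conditions, have major index $n$, and all of whose peaks have even weight. Let $\overline{W}_{k,a}(n)$ denote the number of those partitions enumerated by $B_{k,a}(n)$ in which every odd part appears an even number of times. Then for all $n\ge 0$ \[\overline{W}_{k,a}(n)=\overline{P}_{k,a}(n).\]
   Context: Partitions: a partition of $n$ is a non-increasing finite sequence $\lambda_1\ge\lambda_2\ge\cdots\ge\lambda_s>0$ of positive integers with sum $n$ (the empty partition is the only partition of $0$). For $k\ge a\ge 1$, $B_{k,a}(n)$ denotes the number of partitions $\lambda_1+\cdots+\lambda_s$ of $n$ such that $\lambda_j-\lambda_{j+k-1}\ge 2$ for all $j$ with $1\le j\le s-k+1$, and at most $a-1$ of the $\lambda_j$ are equal to $1$. Lattice paths: a lattice path is a path in the first quadrant ($x,y\ge 0$, integer vertices) that starts on the $y$-axis (at $x=0$), ends on the $x$-axis, and uses unit steps of three kinds: North-East $(x,y)\to(x+1,y+1)$; South-East $(x,y)\to(x+1,y-1)$; East $(x,0)\to(x+1,0)$, which is allowed only at height $0$. A path is either empty or ends with a South-East step. The height of a vertex $(x,y)$ is $y$ and its weight is $x$. A peak is a vertex preceded by a North-East step and followed by a South-East step. The major index of a path is the sum of the weights of its peaks. A path satisfies the special $(k,a)$-conditions if it starts at height $k-a$ and all its vertices have height less than $k$. *)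

(* Defs.v *)
From mathcomp Require Import all_boot.
From mathcomp Require Import zify.
From mathcomp Require Export boolp classical_sets cardinality.
From mathcomp Require Export finmap.

Set Implicit Arguments.
Unset Strict Implicit.
Unset Printing Implicit Defensive.

Local Open Scope nat_scope.

(** ** Partitions *)

Definition is_partition (n : nat) (lam : seq nat) : Prop :=
  [/\ sorted geq lam, 0 \notin lam & sumn lam = n].

(* Parts are numbered from 1: [part lam j] is lambda_j for 1 <= j <= s,
   where s = size lam. *)
Definition part (lam : seq nat) (j : nat) : nat := nth 0 lam j.-1.

(* The range 1 <= j <= s - k + 1, in which s - k + 1 may be negative, is
   written 1 <= j and j + k <= s + 1, to avoid truncated subtraction. *)
Definition B_set (k a n : nat) : set (seq nat) :=
  [set lam | [/\ is_partition n lam,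
    forall j, 1 <= j -> j + k <= (size lam).+1 ->
      2 <= part lam j - part lam (j + k - 1)
    & count_mem 1 lam <= a - 1]]%classic.

Definition odd_parts_even_mult (lam : seq nat) : Prop :=
  forall m, m \in lam -> odd m -> ~~ odd (count_mem m lam).

Definition W_set (k a n : nat) : set (seq nat) :=
  [set lam | B_set k a n lam /\ odd_parts_even_mult lam]%classic.

Definition Wbar (k a n : nat) : nat := #|` fset_set (W_set k a n)|.

(** ** Lattice paths *)

(* A vertex is a pair (x, y); the first quadrant is implicit in [nat]. *)
Definition vertex := (nat * nat)%type.

Definition weight (v : vertex) : nat := v.1.
Definition height (v : vertex) : nat := v.2.

Definition NE_step : rel vertex :=
  [rel v w | (w.1 == v.1.+1) && (w.2 == v.2.+1)].
Definition SE_step : rel vertex :=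
  [rel v w | (w.1 == v.1.+1) && (v.2 == w.2.+1)].
Definition E_step : rel vertex :=
  [rel v w | [&& w.1 == v.1.+1, v.2 == 0 & w.2 == 0]].

Definition lattice_step : rel vertex :=
  [rel v w | [|| NE_step v w, SE_step v w | E_step v w]].

Definition vtx (p : seq vertex) (i : nat) : vertex := nth (0, 0) p i.

(* A path is given by the nonempty sequence of its vertices; the empty path
   (no steps) is a one-element sequence. *)
Definition is_lattice_path (p : seq vertex) : Prop :=
  [/\ 0 < size p,
      weight (vtx p 0) = 0,
      sorted lattice_step p,
      height (vtx p (size p).-1) = 0
    & 1 < size p -> SE_step (vtx p (size p).-2) (vtx p (size p).-1)].

Definition is_peak (p : seq vertex) (i : nat) : bool :=
  [&& 0 < i, i.+1 < size p,
      NE_step (vtx p i.-1) (vtx p i) & SE_step (vtx p i) (vtx p i.+1)].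

Definition major_index (p : seq vertex) : nat :=
  \sum_(0 <= i < size p | is_peak p i) weight (vtx p i).

Definition special_conditions (k a : nat) (p : seq vertex) : Prop :=
  height (vtx p 0) = k - a /\ (forall v, v \in p -> height v < k).

Definition peaks_even (p : seq vertex) : Prop :=
  forall i, is_peak p i -> ~~ odd (weight (vtx p i)).

Definition P_set (k a n : nat) : set (seq vertex) :=
  [set p | [/\ is_lattice_path p, special_conditions k a p,
               major_index p = n & peaks_even p]]%classic.

Definition Pbar (k a n : nat) : nat := #|` fset_set (P_set k a n)|.

(** ** Finiteness

    [fset_set] returns the empty set on infinite sets, so [Wbar] and [Pbar]
    count what they should because of [finite_W_set] and [finite_P_set]. *)

Lemma finite_seqs (T : choiceType) (A : seq T) (n : nat) :
  finite_set [set s : seq T | size s <= n /\ {subset s <= A}]%classic.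
Proof.
elim: n => [|n IHn].
  apply: sub_finite_set (finite_set1 [::]) => s /= [+ _].
  by rewrite leqn0 size_eq0 => /eqP.
have fin2 := finite_image2 (@cons T) (finite_seq A) IHn.
have finU : finite_set ([set [::]] `|` image2 [set` A]
    [set s | size s <= n /\ {subset s <= A}] (@cons T))%classic.
  by rewrite finite_setU; split; first exact: finite_set1.
apply: sub_finite_set finU => -[|x s] /= [lesn sA]; [by left | right].
exists x; first exact/sA/mem_head.
exists s => //=; split=> // y ys.
by apply: sA; rewrite inE ys orbT.
Qed.

Lemma finite_W_set (k a n : nat) : finite_set (W_set k a n).
Proof.
apply: sub_finite_set (finite_seqs (iota 0 n.+1) n).
move=> lam [[[_ lam0 <-] _ _] _]; split.
  elim: lam lam0 => //= x s IHs; rewrite inE negb_or => /andP[x0 /IHs].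
  by move: x0; case: x => // x _; lia.
elim: lam {lam0} => // x s IHs y.
rewrite inE mem_iota [sumn _]/= => /orP[/eqP->|/IHs]; first by lia.
by rewrite mem_iota; lia.
Qed.

Lemma lattice_path_step p i : is_lattice_path p -> i.+1 < size p ->
  lattice_step (vtx p i) (vtx p i.+1).
Proof. by case=> _ _ /(sortedP (0, 0)) + _ _; apply. Qed.

Lemma lattice_path_weight p i : is_lattice_path p -> i < size p ->
  weight (vtx p i) = i.
Proof.
move=> pP; elim: i => [|i IHi] ltip; first by case: pP.
have := lattice_path_step pP ltip; have := IHi (ltnW ltip).
rewrite /lattice_step /NE_step /SE_step /E_step /weight /=.
by move=> -> /or3P[/andP[/eqP]|/andP[/eqP]|/and3P[/eqP]].
Qed.

Lemma peak_le_major_index p i : is_lattice_path p -> is_peak p i ->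
  i <= major_index p.
Proof.
move=> pP pk; have ltip : i < size p by case/and4P: pk => _ /ltnW.
rewrite /major_index big_mkord (bigD1 (Ordinal ltip)) //=.
by rewrite lattice_path_weight // leq_addr.
Qed.

Lemma lattice_path_tail p j : is_lattice_path p ->
  major_index p <= (size p).-2 - j -> j <= (size p).-2 -> 1 < size p ->
  SE_step (vtx p ((size p).-2 - j)) (vtx p ((size p).-2 - j).+1).
Proof.
move=> pP + + szp; elim: j => [|j IHj] lej lejp.
  rewrite subn0; case: pP => _ _ _ _ /(_ szp).
  by have -> : (size p).-2.+1 = (size p).-1 by lia.
set i := _ - _ in lej *.
have iS : (size p).-2 - j = i.+1 by lia.
rewrite iS in IHj; have {}IHj := IHj ltac:(lia) ltac:(lia).
have ltip : i.+2 < size p by lia.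
have := lattice_path_step pP (ltnW ltip).
case/or3P=> [NE|//|E]; last first.
  by move: E IHj; rewrite /SE_step /E_step /= => /and3P[_ _ /eqP->] /andP[].
have pk : is_peak p i.+1 by apply/and4P.
by have := peak_le_major_index pP pk; lia.
Qed.

Lemma lattice_path_size k p : is_lattice_path p ->
  (forall v, v \in p -> height v < k) -> size p <= (major_index p + k).+1.
Proof.
move=> pP hk; set n := major_index p.
case: (leqP (size p) n.+1) => [|ltnp]; first by lia.
have H j : j + n < size p -> height (vtx p n) = height (vtx p (n + j)) + j.
  elim: j => [|j IHj] ltj; first by rewrite addn0 addn0.
  rewrite IHj; last by lia.
  have := @lattice_path_tail p ((size p).-2 - (n + j)) pP.
  have -> : (size p).-2 - ((size p).-2 - (n + j)) = n + j by lia.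
  move=> /(_ ltac:(lia) ltac:(lia) ltac:(lia)).
  by rewrite /SE_step /= (addnS n) /height => /andP[_ /eqP->]; rewrite addSnnS.
have := H ((size p).-1 - n) ltac:(lia).
have : height (vtx p n) < k by apply: hk; apply: mem_nth; apply: ltnW.
by lia.
Qed.

Lemma finite_P_set (k a n : nat) : finite_set (P_set k a n).
Proof.
pose A := [seq (x, y) | x <- iota 0 (n + k).+1, y <- iota 0 k].
apply: sub_finite_set (finite_seqs A (n + k).+1).
move=> p /= [pP [_ hk] mi _]; have szp := lattice_path_size pP hk.
rewrite mi in szp; split=> // v vp.
have wv : weight v < size p.
  have ltvp : index v p < size p by rewrite index_mem.
  have := lattice_path_weight pP ltvp.
  by rewrite /vtx nth_index // => ->.
rewrite (surjective_pairing v); apply: allpairs_f; rewrite mem_iota.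
  by rewrite /= add0n; apply: leq_trans wv szp.
by rewrite /= add0n; apply: hk.
Qed.

(* Main.v *)
Require Import Defs.
From mathcomp Require Import all_boot.
From mathcomp Require Import zify.

(** The proof is a form of the Burge correspondence. Encode a partition by its
    frequency list [s = [:: f_1; f_2; ...]], and let [f_0 = k - a]. The gap
    condition together with the bound on the number of ones says that
    [f_i + f_(i+1) <= k - 1] for all [i >= 0] ([gap_condition_expand]).

    Going from the right, pair each nonzero [f_(i+1)] that is still free with
    [f_i], and in each pair move one unit from index [i+1] to index [i]. If
    index 0 is not in a pair, decrease [f_0] by one unless it is zero. Recording
    [f_0] after each such step gives the heights of a lattice path that starts
    at height [k - a]: [f_0] increases when it is in a pair (North-East step),
    decreases (South-East) or stays at 0 (East). The bound on neighbouring sums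
    is invariant, so the heights stay below [k] ([adj_sums_burge]). The step is
    undone by the mirror rule, pairing from the left ([raise_lower],
    [lower_raise]), so partitions and paths correspond bijectively
    ([burge_inj], [burge_onto]). Each step decreases the size of the partition
    by the number of pairs, and shifts the peaks of the path one unit to the
    left. Since the number of pairs is the number of peaks ([npairs_raise]),
    size corresponds to major index.

    For the parity conditions, note that a step changes the parity of exactly
    the paired frequencies, and that a pair contains exactly one odd index. So,
    if all odd-indexed frequencies are even, then after one step they are odd
    exactly in the pairs used, and after a second step even again. On the path
    side, peaks at even abscissas become peaks at odd ones and then again at
    even ones. The pairs used by a step can differ from the pairs of the
    resulting list; under these parity conditions they have the same odd
    indices as soon as there is no peak at abscissa 1, which is the one peak
    that leaves the path ([odd_paired_raise], [even_mult_raise]).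
    By induction on the path, all peaks have even weight if and only if all odd
    parts have even multiplicity ([burge_path]). *)

(** * The Burge step on frequency lists *)

(** Left-to-right greedy matching: a unit is taken from each nonzero entry met
    while the flag is down and given to the next entry, which is then skipped.
    The flag says that a unit arrives from the left of the list. For a whole
    frequency list this unit comes from the entry of index 0, which stands for
    the current height of a path and is kept outside the list. *)
Fixpoint raise (b : bool) (s : seq nat) : seq nat :=
  if s is x :: s' then
    if b then x.+1 :: raise false s' else x.-1 :: raise (0 < x) s'
  else nseq b 1.

(** Whether the head is the upper member of a pair in the right-to-left greedy
    matching, in which every nonzero entry that is not yet matched is paired
    with its left neighbour. Such a head is paired with the entry to the left
    of the list. *)
Fixpoint carry (s : seq nat) : bool :=
  if s is x :: s' then ~~ carry s' && (0 < x) else false.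

Definition trim_cons (x : nat) (s : seq nat) : seq nat :=
  if (x == 0) && (s == [::]) then [::] else x :: s.

(** Each pair of the right-to-left matching sends one unit from its upper to
    its lower member; the unit that [carry] announces leaves the list. Trailing
    zeros created on the way are removed, so that each partition keeps one
    frequency list. *)
Fixpoint lower (s : seq nat) : seq nat :=
  if s is x :: s' then
    trim_cons (if carry s' then x.+1 else x.-1) (lower s')
  else [::].

(** The default value makes the empty list trimmed. *)
Definition trimmed (s : seq nat) : bool := last 1 s != 0.

Fixpoint npairs (s : seq nat) : nat :=
  if s is x :: s' then carry s + npairs s' else 0.

Fixpoint wsum (j : nat) (s : seq nat) : nat :=
  if s is x :: s' then j * x + wsum j.+1 s' else 0.

Fixpoint adj_sums (c : nat) (s : seq nat) : bool :=
  if s is x :: s' then (x + head 0 s' <= c) && adj_sums c s' else true.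

Fixpoint even_mult (o : bool) (s : seq nat) : bool :=
  if s is x :: s' then (o ==> ~~ odd x) && even_mult (~~ o) s' else true.

(** [o] is the parity of the index of the head. Over the odd indices,
    [odd_paired] asks that an entry be odd exactly when the right-to-left
    matching pairs it: the entry [x] is the lower member of a pair when
    [carry s'], and otherwise its upper member as soon as it is nonzero. This
    is what [even_mult] becomes after one Burge step. *)
Fixpoint odd_paired (o : bool) (s : seq nat) : bool :=
  if s is x :: s' then
    (o ==> (odd x == carry s' || (0 < x))) && odd_paired (~~ o) s'
  else true.

Lemma trimmed_cons x s :
  trimmed (x :: s) = (trim_cons x s == x :: s) && trimmed s.
Proof.
rewrite /trimmed /trim_cons; case: s => [|y s] /=; last by rewrite andbF eqxx.
by case: x => //= x; rewrite eqxx.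
Qed.

Lemma trimmed_trim_cons x s : trimmed s -> trimmed (trim_cons x s).
Proof. by rewrite /trimmed /trim_cons; case: s x => [|y s] [|x]. Qed.

Lemma trimmed_lower s : trimmed (lower s).
Proof. by elim: s => //= x s IHs; apply: trimmed_trim_cons. Qed.

Lemma trimmed_raise b s : trimmed s -> trimmed (raise b s).
Proof.
rewrite /trimmed; elim: s b => [|x s IHs] [] //=; case: s IHs => [|y s] //= IHs.
- by move=> /(IHs false).
- by case: x.
- by move=> /(IHs (0 < x)); case: (0 < x).
Qed.

Lemma carry_raise b s : carry (raise b s) = b.
Proof.
elim: s b => [|x s IHs] [] //=; rewrite IHs //.
by case: x.
Qed.

Lemma raise_trim_cons b x s : raise b (trim_cons x s) =
  trim_cons (if b then x.+1 else x.-1) (raise (~~ b && (0 < x)) s).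
Proof.
rewrite /trim_cons; case: b x s => [] [|[|x]] [|y s] //=.
Qed.

(** The left-to-right matching of [lower s] recovers the pairs of [s]: a lower
    member has just received a unit, hence is nonzero, and unpaired entries of
    [s] are zero, so nothing else can be matched before it. *)
Lemma raise_lower s : trimmed s -> raise (carry s) (lower s) = s.
Proof.
elim: s => // x s IHs; rewrite trimmed_cons => /andP[/eqP xs /IHs {}IHs] /=.
rewrite raise_trim_cons -[RHS]xs -[in RHS]IHs.
by case: (carry s) => //=; case: x {xs}.
Qed.

Lemma lower_raise b s : trimmed s -> lower (raise b s) = s.
Proof.
elim: s b => [|x s IHs] b; first by case: b.
rewrite trimmed_cons => /andP[/eqP xs /IHs {}IHs].
by rewrite -{2}xs; case: b => /=; rewrite carry_raise IHs //; case: x {xs}.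
Qed.

(** Moving the units up keeps the pairs or shifts them by one place, so their
    number can only change at the left end: a new pair appears when a unit
    enters from the left and the head of [s] was not already paired to the
    left. On paths this event is a peak at the second vertex. *)
Lemma npairs_raise b s : npairs (raise b s) = npairs s + (b && ~~ carry s).
Proof.
elim: s b => [|x s IHs] [] //=; rewrite IHs carry_raise.
  by case: (carry s); lia.
by case: x => [|x]; case: (carry s); lia.
Qed.

(** The last entry of a trimmed list is nonzero, hence the upper member of a
    pair. This makes the Burge step decrease the weighted sum. *)
Lemma npairs_gt0 s : trimmed s -> s != [::] -> 0 < npairs s.
Proof.
elim: s => // x s IHs; rewrite trimmed_cons => /andP[+ /IHs {}IHs] _.
by case: s IHs => [|y s] IHs; [case: x | have := IHs isT => /=; lia].
Qed.

(** Every pair of [raise b s] has moved one unit up by one index; the unit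
    coming from the left, if any, enters with weight [j.+1], of which 1 is
    accounted for by its pair. *)
Lemma wsum_raise j b s : wsum j.+1 (raise b s) =
  wsum j.+1 s + npairs (raise b s) + j * b.
Proof.
elim: s j b => [|x s IHs] j [] //=; rewrite ?muln0 ?muln1 ?IHs ?carry_raise //.
- by lia.
- by rewrite /=; lia.
- by case: x => [|x] /=; lia.
Qed.

Lemma head_raise b s :
  head 0 (raise b s) = if b then (head 0 s).+1 else (head 0 s).-1.
Proof. by case: s b => [|x s] []. Qed.

(** Moving the units preserves the sum of a pair and the sum of two neighbours
    that belong to consecutive pairs. In any other sum one neighbour is zero
    and the other is at most the sum of its pair. The last condition bounds the
    head when its pair extends to the left of the list. *)
Lemma adj_sums_raise c b s :
  adj_sums c (raise b s) = adj_sums c s && (b ==> (head 0 s < c)).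
Proof.
elim: s b => [|x s IHs] [] /=; rewrite ?addn0 ?andbT ?IHs ?head_raise //=.
  case: s {IHs} => [|y s] /=; first by lia.
  by case: (adj_sums c s) => /=; lia.
case: x => [|x] /=; rewrite ?andbT; last by case: (adj_sums c s) => /=; lia.
case: s {IHs} => [|y s] //=.
by case: (adj_sums c s) => /=; lia.
Qed.

(** Exactly the paired entries change by one unit, hence change parity. *)
Lemma odd_paired_raise o b s : odd_paired o (raise b s) = even_mult o s.
Proof.
elim: s o b => [|x s IHs] o []; rewrite /= ?implybT ?IHs ?carry_raise //.
  by case: (odd x).
by case: x => //= x; case: (odd x).
Qed.

(** Again the paired entries change parity, but these are the pairs of
    [raise b s], whereas [odd_paired] refers to the pairs of [s]. A pair of
    indices [t-1, t] in [raise b s] may become [t-2, t-1] in [s], which matters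
    only for odd [t]. If the entries of [raise b s] at odd indices are even,
    the entry [t] stays nonzero when it loses a unit, so such a shift cannot
    start. If [s] is [odd_paired], the entry [t-2] of [s] is nonzero, hence it
    was itself the upper member of a pair, and this pair has shifted too: the
    shift propagates to the left end, where the last condition excludes it. *)
Lemma even_mult_raise o b s : even_mult o (raise b s) =
  odd_paired o s && ((o == b) ==> (carry s == b)).
Proof.
elim: s o b => [|x s IHs] [] [] //=; rewrite ?IHs //=; case: x => [|x] //=.
all: by case: (carry s); case: (odd_paired _ _) => //=; case: (odd x).
Qed.

(** * Partitions and their frequency lists *)

Lemma geq_transitive : transitive geq.
Proof. by move=> a b c /= ba ac; apply: leq_trans ac ba. Qed.

Fixpoint expand (j : nat) (s : seq nat) : seq nat :=
  if s is x :: s' then expand j.+1 s' ++ nseq x j else [::].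

Lemma count_expand v j s :
  count_mem v (expand j s) = if j <= v then nth 0 s (v - j) else 0.
Proof.
elim: s j => [|x s IHs] j /=; first by rewrite nth_nil if_same.
rewrite count_cat IHs count_nseq; case: (ltngtP j v) => [ltjv|ltvj|<-] /=.
- by rewrite -[v - j]prednK ?subn_gt0 // -subnS /= ltn_eqF //= mul0n addn0.
- by rewrite gtn_eqF.
- by rewrite subnn eqxx mul1n.
Qed.

Lemma mem_expand v j s : v \in expand j s -> j <= v.
Proof. by rewrite -has_pred1 has_count count_expand; case: ifP. Qed.

Lemma sorted_expand j s : sorted geq (expand j s).
Proof.
elim: s j => //= x s IHs j.
rewrite (sorted_pairwise geq_transitive) pairwise_cat.
rewrite -!(sorted_pairwise geq_transitive) IHs.
apply/andP; split; last first.
  by elim: x => //= -[|x] //= ->; rewrite leqnn.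
apply/allrelP => v w /mem_expand ltjv /nseqP[-> _].
exact: ltnW.
Qed.

Lemma sumn_expand j s : sumn (expand j s) = wsum j s.
Proof.
by elim: s j => //= x s IHs j; rewrite sumn_cat IHs sumn_nseq addnC.
Qed.

Lemma trimmed_eq s t : trimmed s -> trimmed t ->
  (forall i, nth 0 s i = nth 0 t i) -> s = t.
Proof.
elim: s t => [|x s IHs] [|y t] //.
- move=> _ tt /(_ (size t)); rewrite nth_nil -last_nth => E.
  by move: tt; rewrite /trimmed /= -E.
- move=> ts _ /(_ (size s)); rewrite nth_nil -last_nth => E.
  by move: ts; rewrite /trimmed /= E.
rewrite !trimmed_cons => /andP[_ ts] /andP[_ tt] E.
by have /= -> := E 0; rewrite (IHs t ts tt) // => i; apply: (E i.+1).
Qed.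

Lemma expand_inj : {in trimmed &, injective (expand 1)}.
Proof.
move=> s t ts tt E; apply: trimmed_eq => // i.
by have := count_expand i.+1 1 t; rewrite -E count_expand !subn1.
Qed.

Lemma expand_onto lam : sorted geq lam -> 0 \notin lam ->
  exists2 s, trimmed s & expand 1 s = lam.
Proof.
move=> slam lam0.
have ub v : v \in lam -> v <= head 0 lam.
  case: lam slam {lam0} => //= x lam; rewrite (path_sortedE geq_transitive).
  by move=> /andP[/allP xlam _]; rewrite inE => /orP[/eqP->|/xlam].
exists [seq count_mem i lam | i <- iota 1 (head 0 lam)].
  case: lam lam0 {slam ub} => // x lam lam0; rewrite /trimmed.
  case: x lam0 => // x _; rewrite [head _ _]/= -[X in iota _ X]addn1 iotaD.
  by rewrite map_cat last_cat /= add1n eqxx.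
apply: (@sorted_eq _ geq) => //.
- exact: geq_transitive.
- by move=> a b; rewrite andbC => /anti_leq.
- exact: sorted_expand.
apply/allP => v _ /=; rewrite count_expand; apply/eqP.
case: v => [|v]; first by rewrite (count_memPn lam0).
rewrite subn1 /=; case: (ltnP v (head 0 lam)) => ltv.
  by rewrite (nth_map 0) ?size_iota // nth_iota.
rewrite nth_default ?size_map ?size_iota //; apply/esym/count_memPn.
by apply/negP => /ub; rewrite leqNgt ltnS ltv.
Qed.

(** In a non-increasing list the entries larger than [v] form an initial
    segment. *)
Lemma leq_nth_count lam v m : sorted geq lam ->
  (v.+1 <= nth 0 lam m) = (m < count (leq v.+1) lam).
Proof.
elim: lam m => [|x lam IHlam] m /=; first by rewrite nth_nil.
rewrite (path_sortedE geq_transitive) => /andP[/allP xlam /IHlam {}IHlam].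
case: (ltnP v x) => vx; first by case: m => [|m] //=; rewrite IHlam.
have C0 : count (leq v.+1) lam = 0.
  rewrite (@eq_in_count _ _ pred0) ?count_pred0 // => y /xlam yx.
  by apply/negbTE; rewrite -leqNgt (leq_trans yx).
case: m => [|m] /=; last by rewrite IHlam C0.
by rewrite C0 ltnNge vx.
Qed.

Lemma count_leq_split lam v :
  count (leq v) lam = count_mem v lam + count (leq v.+1) lam.
Proof. by elim: lam => //= x lam ->; case: (ltngtP v x); lia. Qed.

Lemma adj_sumsP c s :
  reflect (forall i, nth 0 s i + nth 0 s i.+1 <= c) (adj_sums c s).
Proof.
apply: (iffP idP).
  elim: s => [|x s IHs] /=; first by move=> _ i; rewrite !nth_nil.
  move=> /andP[xs /IHs {}IHs] [|i] /=; first by rewrite nth0.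
  exact: IHs.
elim: s => //= x s IHs E; rewrite IHs => [|i]; last exact: (E i.+1).
by rewrite andbT -nth0; apply: (E 0).
Qed.

(** If [k] consecutive parts differ by at most 1, they all have size [i] or
    [i.+1], where [i] is the last of them, so the frequencies of these two
    sizes add up to at least [k]; conversely the parts of size [i] or [i.+1]
    are consecutive. Both directions compare the number of parts that are at
    least [i] with the number of those that are at least [i.+2]. *)
Lemma gap_condition_expand k s (lam := expand 1 s) : 0 < k ->
  (forall j, 1 <= j -> j + k <= (size lam).+1 ->
      2 <= part lam j - part lam (j + k - 1)) <-> adj_sums k.-1 s.
Proof.
move=> k0; have slam : sorted geq lam by apply: sorted_expand.
have lam0 : 0 \notin lam by apply/negP => /mem_expand.
have freq i : nth 0 s i + nth 0 s i.+1 + count (leq i.+3) lam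
              = count (leq i.+1) lam.
  rewrite (count_leq_split _ i.+1) (count_leq_split _ i.+2).
  by rewrite /lam !count_expand !subn1 addnA.
clearbody lam; split=> [gap|/adj_sumsP ad j j1 jk].
  apply/adj_sumsP => i; rewrite leqNgt; apply/negP => big.
  set m := count (leq i.+3) lam in freq.
  have ltm : m + k.-1 < count (leq i.+1) lam by rewrite -freq; lia.
  have := gap m.+1 isT; have := count_size (leq i.+1) lam => szlam.
  have := leq_nth_count lam i (m + k.-1) slam; rewrite ltm => ge_i.
  have := leq_nth_count lam i.+2 m slam; rewrite ltnn => lt_i.
  rewrite /part /= => /(_ ltac:(lia)).
  have -> : (m.+1 + k - 1).-1 = m + k.-1 by lia.
  by lia.
rewrite /part; set y := nth _ _ (_ - _).-1.
have ltlam : (j + k - 1).-1 < size lam by lia.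
have y_lam : y \in lam by apply: mem_nth.
have y0 : 0 < y by rewrite lt0n; apply: contraNneq lam0 => <-.
have := leq_nth_count lam y.-1 (j + k - 1).-1 slam.
rewrite -/y prednK // leqnn -(prednK y0) -freq => /esym lty.
have ad_y := ad y.-1; have := leq_nth_count lam y.-1.+2 j.-1 slam.
have -> : j.-1 < count (leq y.-1.+3) lam by lia.
by lia.
Qed.

Lemma even_multP b s : reflect
  (forall i, b (+) odd i -> ~~ odd (nth 0 s i)) (even_mult b s).
Proof.
apply: (iffP idP).
  elim: s b => [|x s IHs] b /=; first by move=> _ i; rewrite nth_nil.
  move=> /andP[bx /IHs {}IHs] [|i] /=; first by rewrite addbF => /(implyP bx).
  by move=> bi; apply: IHs; case: b bi {bx}; case: (odd i).
elim: s b => //= x s IHs b E; rewrite IHs => [|i bi]; last first.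
  by apply: (E i.+1) => /=; case: b bi {E}; case: (odd i).
by rewrite andbT; apply/implyP => b1; apply: (E 0); rewrite addbF.
Qed.

Lemma odd_parts_expand s :
  odd_parts_even_mult (expand 1 s) <-> even_mult true s.
Proof.
split=> [E|/even_multP E m mlam om].
  apply/even_multP => i oi; have := E i.+1; rewrite count_expand subn1 /=.
  case: (boolP (i.+1 \in _)) => [_ /(_ isT)|/count_memPn]; first exact.
  by rewrite count_expand subn1 /= => ->.
rewrite count_expand; case: m om {mlam} => // m om.
by rewrite ltn0Sn subn1; apply: E.
Qed.

(** * The Burge correspondence on height sequences *)

(** The height sequences of lattice paths. Thanks to [0.-1 = 0], an East step
    is a descent from height 0, so a step is determined by whether it goes up.
    The middle condition forbids ending with an East step. *)
Fixpoint profile (hs : seq nat) : bool :=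
  if hs is h :: t then
    if t is h' :: t' then
      [&& (h' == h.+1) || (h' == h.-1), (t' == [::]) ==> (h == 1) & profile t]
    else h == 0
  else false.

(** The path is read backwards: each step, when prepended, raises the frequency
    list of the rest of the path, with a unit taken from height for a
    North-East step. *)
Fixpoint burge (hs : seq nat) : seq nat :=
  if hs is h :: t then
    if t is h' :: _ then raise (h < h') (burge t) else [::]
  else [::].

Lemma trimmed_burge hs : trimmed (burge hs).
Proof. by elim: hs => // h [|h' t] //= IHt; apply: trimmed_raise. Qed.

(** The first step can be read off the frequency list, which makes [burge]
    injective. *)
Lemma carry_burge h h' t : carry (burge [:: h, h' & t]) = (h < h').
Proof. exact: carry_raise. Qed.

Lemma adj_sums_head c s : adj_sums c s -> head 0 s <= c.
Proof.
by case: s => //= x s /andP[xs _]; apply: leq_trans xs; apply: leq_addr.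
Qed.

(** With the starting height as the entry of index 0, the bound on heights
    turns into the bound on sums of neighbouring frequencies, since
    prepending a step adds the same condition to both, the bound on the new
    height. *)
Lemma adj_sums_burge c h t : profile (h :: t) ->
  adj_sums c (h :: burge (h :: t)) = all (fun y => y <= c) (h :: t).
Proof.
elim: t h => [|h' t IHt] h; first by move=> _ /=; rewrite addn0 !andbT.
case/and3P=> st _ pt; have {IHt pt} IHt := IHt h' pt.
transitivity ((h <= c) && adj_sums c (h' :: burge (h' :: t))); last first.
  by rewrite IHt.
rewrite [burge _]/= /= -/(burge (h' :: t)) adj_sums_raise head_raise.
case: (boolP (adj_sums c _)) => [/adj_sums_head sc|_]; last first.
  by rewrite /= !andbF.
by case/orP: st sc => /eqP->; case: ltnP; lia.
Qed.

(** A path with an empty frequency list is a plain descent; here only the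
    consequence that distinguishes the empty path is recorded. *)
Lemma burge_nil h t : profile (h :: t) -> burge (h :: t) = [::] ->
  (h == 0) = (t == [::]).
Proof.
elim: t h => [|h' t IHt] h; first by move=> /= /eqP->.
case/and3P=> st last_h pt; rewrite [burge _]/= -/(burge (h' :: t)).
have := trimmed_burge (h' :: t); have := IHt h' pt.
case: (burge _) => [|x s] IH; last first.
  by move=> tr E; have := lower_raise (h < h') _ tr; rewrite E.
case: ltnP => //= h'h _ _; move: (IH erefl) last_h => <-.
by case: h st h'h => //; case: h' {pt IH}.
Qed.

Lemma burge_inj h t1 t2 : profile (h :: t1) -> profile (h :: t2) ->
  burge (h :: t1) = burge (h :: t2) -> t1 = t2.
Proof.
elim: t1 h t2 => [|h1 t1 IHt] h [|h2 t2] //.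
- by move=> h0 p2 /esym E; move: (burge_nil _ _ p2 E); rewrite [h == 0]h0.
- by move=> p1 h0 E; move: (burge_nil _ _ p1 E); rewrite [h == 0]h0.
case/and3P=> st1 _ p1 /and3P[st2 _ p2] E.
have Eb : (h < h1) = (h < h2) by rewrite -(carry_burge h h1 t1) E carry_burge.
have Eh : h1 = h2.
  by move: Eb; case/orP: st1 st2 => /eqP-> /orP[] /eqP->; lia.
subst h2; congr (_ :: _); apply: (IHt h1) => //.
rewrite -(lower_raise (h < h1) _ (trimmed_burge (h1 :: t1))).
by rewrite -(lower_raise (h < h1) _ (trimmed_burge (h1 :: t2))); congr lower.
Qed.

(** Undo the Burge step until the list is empty, the flag [carry] telling
    whether the path goes up; then descend to the axis. *)
Lemma burge_onto h s : trimmed s ->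
  exists2 t, profile (h :: t) & burge (h :: t) = s.
Proof.
have [n] := ubnP (wsum 1 s); elim: n s h => // n IHn s h ltn tr.
case: (eqVneq s [::]) => [->|s0].
  elim: h => [|h [t pt bt]]; first by exists [::].
  exists (h :: t); last by rewrite /= ltnNge leqnSn /= -/(burge (h :: t)) bt.
  apply/and3P; split; rewrite ?eqxx ?orbT //.
  by apply/implyP=> /eqP t0; move: pt; rewrite t0 /=.
have Es := raise_lower s tr; set b := carry s in Es.
have wlt : wsum 1 (lower s) < n.
  have := wsum_raise 0 b (lower s); rewrite Es mul0n addn0.
  by have := npairs_gt0 s tr s0; lia.
have [t pt bt] := IHn _ (if b then h.+1 else h.-1) wlt (trimmed_lower s).
set h' := if b then _ else _ in pt bt.
have hh' : (h < h') = b by rewrite /h'; case: (b); lia.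
exists (h' :: t); last first.
  by rewrite [burge _]/= -/(burge (h' :: t)) hh' bt.
apply/and3P; split=> //; first by rewrite /h'; case: (b); rewrite eqxx ?orbT.
apply/implyP => /eqP t0; move: pt bt Es; rewrite t0 => /= h'0 <-.
move: h'0; rewrite /h'; case: (b) => //= _ sE.
by move: s0; rewrite -sE.
Qed.

(** * Transfer to lattice paths *)

Lemma lattice_stepE v w : weight w = (weight v).+1 -> lattice_step v w =
  (height w == (height v).+1) || (height w == (height v).-1).
Proof.
case: v w => [x h] [y h']; rewrite /lattice_step /weight /height /= => ->.
by rewrite /NE_step /SE_step /E_step /= eqxx /=; lia.
Qed.

Lemma step_weight v w : lattice_step v w -> weight w = (weight v).+1.
Proof. by case/or3P=> [/andP[/eqP]|/andP[/eqP]|/and3P[/eqP]]. Qed.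

Lemma step_height v w : lattice_step v w ->
  (height w == (height v).+1) || (height w == (height v).-1).
Proof. by move=> vw; rewrite -(lattice_stepE v w (step_weight v w vw)). Qed.

Lemma NE_stepE v w : lattice_step v w -> NE_step v w = (height v < height w).
Proof.
move=> vw; have := step_height v w vw; have := step_weight v w vw.
by rewrite /NE_step /weight /height /= => ->; rewrite eqxx /=; lia.
Qed.

Lemma SE_stepE v w : lattice_step v w -> SE_step v w = (height w < height v).
Proof.
move=> vw; have := step_height v w vw; have := step_weight v w vw.
by rewrite /SE_step /weight /height /= => ->; rewrite eqxx /=; lia.
Qed.

Lemma lattice_pathE p : is_lattice_path p <->
  [/\ sorted lattice_step p, weight (vtx p 0) = 0 & profile (map height p)].
Proof.
suff E : sorted lattice_step p -> profile (map height p) <->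
   [/\ 0 < size p, height (vtx p (size p).-1) = 0
     & 1 < size p -> SE_step (vtx p (size p).-2) (vtx p (size p).-1)].
  split=> [[p0 w0 sp hp SE]|[sp w0 /(E sp)[p0 hp SE]]]; last by split.
  by split=> //; apply/E.
elim: p => [|v [|w p] IHp]; first by move=> _; split=> // -[].
  by move=> _ /=; split=> [/eqP|[_ + _]]; [split | move=> /eqP].
move=> /= /andP[vw /IHp {}IHp]; rewrite (step_height _ _ vw) /=.
split=> [/andP[lst /IHp[_ hp SE]]|[_ hp SE]].
  split=> // _; case: p lst hp SE {IHp} => [|u p] lst hp SE; last exact: SE.
  rewrite [SE_step _ _](SE_stepE v w) // (eqP lst).
  by move: hp; rewrite /vtx /= => ->.
apply/andP; split; last first.
  apply/IHp; split=> //; case: p hp SE {IHp} => // u p hp SE _; exact: SE.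
apply/implyP; case: p hp SE {IHp} => // hp /(_ isT).
rewrite [SE_step _ _](SE_stepE v w) // => lt_wv _.
by move: hp lt_wv (step_height v w vw); rewrite /vtx /= => ->; lia.
Qed.

Lemma major_index_cons v p : major_index (v :: p) =
  is_peak (v :: p) 1 * weight (vtx p 0) + major_index p.
Proof.
rewrite /major_index big_mkcond [in RHS]big_mkcond big_nat_recl //= add0n.
case: p => [|w p]; first by rewrite !big_geq // muln0.
rewrite !(big_nat_recl (size p)) //= add0n.
by congr (_ + _); case: is_peak; rewrite ?mul1n ?mul0n.
Qed.

(** The frequency list of the rest of the path knows by [carry] whether the
    second step goes up. *)
Lemma first_peak v w p : sorted lattice_step [:: v, w & p] ->
  profile (map height [:: v, w & p]) ->
  is_peak [:: v, w & p] 1 =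
  (height v < height w) && ~~ carry (burge (map height (w :: p))).
Proof.
move=> /= /andP[vw wp] /and3P[_ _ pw].
rewrite /is_peak /vtx /=; case: p wp pw => [|u p] wp pw /=.
  by move: pw => /= /eqP->; rewrite ltn0.
case/andP: wp => wu _; rewrite carry_raise NE_stepE // SE_stepE //.
by have := step_height w u wu; lia.
Qed.

(** Both claims are proved for a path starting at any abscissa. Passing to the
    tail shifts the origin by one: a pair, that is a peak, then weighs one unit
    more, and the parity required of the frequencies alternates. When the
    starting abscissa is even, a peak at the second vertex is forbidden, which
    is the extra condition in [even_mult_raise]. *)
Lemma burge_path v p : sorted lattice_step (v :: p) ->
  profile (map height (v :: p)) ->
  major_index (v :: p) = wsum 1 (burge (map height (v :: p)))
    + weight v * npairs (burge (map height (v :: p))) /\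
  (peaks_even (v :: p) <->
   (if odd (weight v) then odd_paired else even_mult) true
     (burge (map height (v :: p)))).
Proof.
elim: p v => [|w p IHp] v sp pp.
  split; first by rewrite major_index_cons /major_index big_geq ?muln0.
  split=> [_|_ [|[|i]]] //; by case: ifP.
have pk := first_peak _ _ _ sp pp.
case/andP: (sp) => vw sp'; case/and3P: (pp) => _ _ pp'.
have {IHp} [IHm IHe] := IHp w sp' pp'.
have ww : weight w = (weight v).+1 by exact: step_weight.
have Es : burge (map height [:: v, w & p])
  = raise (height v < height w) (burge (map height (w :: p))) by [].
move: (burge (map height (w :: p))) Es pk IHm IHe => s ->.
move: (height v < height w) => b pk IHm IHe; split.
  rewrite major_index_cons IHm pk wsum_raise mul0n addn0 npairs_raise.
  rewrite /vtx /= ww.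
  by case: (b && _); lia.
have -> : peaks_even [:: v, w & p] <->
    (is_peak [:: v, w & p] 1 -> odd (weight v)) /\ peaks_even (w :: p).
  split=> [E|[E1 E] [|[|i]]] //; last exact: (E i.+1).
    split=> [/E|[|i] //]; last exact: (E i.+2).
    by rewrite /vtx /= ww /= negbK.
  by move=> /E1; rewrite /vtx /= ww /= negbK.
rewrite IHe ww pk /=; case: (odd (weight v)) => /=.
  by rewrite odd_paired_raise; split=> [[]|].
rewrite even_mult_raise.
by case: b (carry s) {pk} => [] [] /=; rewrite ?andbT ?andbF;
  split=> // -[] // /(_ isT).
Qed.

(** * The two bijections *)

(** The height [k - a] is put in front as the frequency of index 0: then the
    bound on the number of ones is one more bound on the sum of two
    neighbouring frequencies. *)
Definition freq_set (k a n : nat) : set (seq nat) :=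
  [set s | [/\ trimmed s, adj_sums k.-1 (k - a :: s), wsum 1 s = n
    & even_mult true s]]%classic.

Lemma W_set_expand k a n : 1 <= a -> a <= k ->
  W_set k a n = (expand 1 @` freq_set k a n)%classic.
Proof.
move=> a1 ak; have k0 : 0 < k by lia.
have headE s : (count_mem 1 (expand 1 s) <= a - 1) = (k - a + head 0 s <= k.-1).
  by rewrite count_expand leqnn subnn nth0; lia.
apply/seteqP.
split=> [lam [[[slam lam0 nlam] gap ones] odds]|_ [s [ts ad ws ev] <-]].
  have [s ts Es] := expand_onto lam slam lam0; subst lam.
  exists s => //; split=> //.
  - by rewrite /= -headE ones; apply/(gap_condition_expand k s k0).
  - by rewrite -sumn_expand.
  - exact/odd_parts_expand.
move: ad => /= /andP[hd ad]; split; last exact/odd_parts_expand.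
split; [split | exact/(gap_condition_expand k s k0) | by rewrite headE].
- exact: sorted_expand.
- by apply/negP => /mem_expand.
- by rewrite sumn_expand.
Qed.

Lemma lattice_path_eq p q : is_lattice_path p -> is_lattice_path q ->
  map height p = map height q -> p = q.
Proof.
move=> pP qP E; have sz : size p = size q.
  by rewrite -(size_map height p) E size_map.
apply: (@eq_from_nth _ (0, 0)) => // i ip; have iq : i < size q by rewrite -sz.
rewrite [LHS]surjective_pairing [RHS]surjective_pairing.
congr pair.
  have := lattice_path_weight pP ip; have := lattice_path_weight qP iq.
  by rewrite /weight /vtx => -> ->.
by have := congr1 (nth 0 ^~ i) E; rewrite !(nth_map (0, 0)).
Qed.

Lemma P_set_burge k a n p : 1 <= a -> a <= k -> is_lattice_path p ->
  height (vtx p 0) = k - a ->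
  P_set k a n p <-> freq_set k a n (burge (map height p)).
Proof.
move=> a1 ak pP p0.
have [sp w0 pp] := (lattice_pathE p).1 pP.
case: p pP p0 sp w0 pp => [[]//|v p] pP p0 sp w0 pp.
have [mE eE] := burge_path v p sp pp.
have := trimmed_burge (map height (v :: p)).
have adE := adj_sums_burge k.-1 _ _ pp.
move: adE mE eE; rewrite [weight v]w0 mul0n addn0 -/(map height (v :: p)).
move: (burge (map height (v :: p))) => s; rewrite [height v]p0 => adE mE eE ts.
have hE : adj_sums k.-1 (k - a :: s) <->
    (forall u, u \in v :: p -> height u < k).
  rewrite adE all_map.
  split=> [/allP E u /E /=|E]; first by lia.
  by apply/allP => u /E /=; lia.
split=> [[_ [_ hk] mi pe]|[_ ad mi ev]].
  split; [by [] | exact/hE | by rewrite -mi mE | exact/eE].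
by split; [|split=> //; apply/hE| rewrite mE |apply/eE].
Qed.

Lemma path_of_profile o h t : profile (h :: t) ->
  exists2 p, path lattice_step (o, h) p & map height p = t.
Proof.
elim: t o h => [|h' t IHt] o h; first by exists [::].
case/and3P=> st _ /(IHt o.+1)[p pp <-]; exists ((o.+1, h') :: p) => //.
by rewrite /= pp andbT lattice_stepE.
Qed.

Lemma burge_P_set k a n : 1 <= a -> a <= k ->
  ((fun p => burge (map height p)) @` P_set k a n = freq_set k a n)%classic.
Proof.
move=> a1 ak; apply/seteqP; split=> [_ [p pP <-] | s sF].
  by case: (pP) => lp [p0 _] _ _; apply/P_set_burge.
have [ts _ _ _] := sF; have [t pt bt] := burge_onto (k - a) s ts.
have [p pp hp] := path_of_profile 0 _ _ pt.
have hs : map height ((0, k - a) :: p) = k - a :: t by rewrite /= hp.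
exists ((0, k - a) :: p); last by rewrite hs.
apply/P_set_burge; rewrite ?hs ?bt //.
by apply/lattice_pathE; split; rewrite ?hs.
Qed.

Lemma burge_P_inj k a n :
  {in P_set k a n &, injective (fun p => burge (map height p))}.
Proof.
move=> p q /set_mem[pP [p0 _] _ _] /set_mem[qP [q0 _] _ _].
have [_ _ pp] := (lattice_pathE p).1 pP.
have [_ _ pq] := (lattice_pathE q).1 qP.
move=> E; apply: lattice_path_eq => //.
case: p q p0 q0 pp pq E {pP qP} => [|v p] [|w q] // p0 q0.
rewrite /= [height v]p0 [height w]q0 => pp pq E; congr (_ :: _).
exact: burge_inj pp pq E.
Qed.

Theorem theorem1p11 (k a : nat) (ha : 1 <= a) (hka : a <= k) (n : nat) :
  Wbar k a n = Pbar k a n.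
Proof.
apply/(fcard_eq (finite_W_set k a n) (finite_P_set k a n)).
rewrite W_set_expand //.
apply: card_eq_trans (inj_card_eq _) _.
  by move=> s t /set_mem[ts _ _ _] /set_mem[tt _ _ _]; apply: expand_inj.
rewrite -burge_P_set //; apply: inj_card_eq; exact: burge_P_inj.
Qed.
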